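(* Let $\mathfrak g=\mathfrak h\oplus\mathfrak k$ be a semidirect product Lie algebra, with $\mathfrak h$ a subalgebra and $\mathfrak k$ an ideal, attached to the representation $\pi:\mathfrak h\to\operatorname{End}(\mathfrak k)$. Let $j:\mathfrak h\to\mathfrak k$ be a linear isomorphism and $\langle\cdot,\cdot\rangle$ an inner product on $\mathfrak h$ such that $\tilde\pi(x):=j^{-1}\pi(x)j\in\mathfrak{so}(\mathfrak h)$ for every $x\in\mathfrak h$. Let $J(x,v)=(-j^{-1}v,jx)$ and let $g((x,u),(y,v))=\langle x,y\rangle+\langle j^{-1}u,j^{-1}v\rangle$ on $\mathfrak g$. If $(g,J)$ is almost Kähler, then $(g,J)$ is Kähler.
   Context: All Lie algebras are real and finite-dimensional. A semidirect product Lie algebra $\mathfrak g=\mathfrak h\oplus\mathfrak k$ is a vector space direct sum of a Lie subalgebra $\mathfrak h$ and an ideal $\mathfrak k$; its bracket is $[x,y]=[x,y]_{\mathfrak h}$, $[x,v]=\pi(x)v$, $[u,v]=[u,v]_{\mathfrak k}$ for $x,y\in\mathfrak h$, $u,v\in\mathfrak k$, where $\pi$ acts by derivations of $\mathfrak k$. $\mathfrak{so}(\mathfrak h)$ denotes the endomorphisms of $\mathfrak h$ that are skew-symmetric with respect to $\langle\cdot,\cdot\rangle$. The fundamental $2$-form is $\omega(X,Y)=g(JX,Y)$. $(g,J)$ is almost Kähler if $\omega$ is closed, i.e. $\omega([X,Y],Z)+\omega([Y,Z],X)+\omega([Z,X],Y)=0$ for all $X,Y,Z\in\mathfrak g$.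 $(g,J)$ is Kähler if moreover $J$ is integrable, i.e. $[JY,JZ]-[Y,Z]-J[JY,Z]-J[Y,JZ]=0$ for all $Y,Z\in\mathfrak g$. *)

(* Defs.v *)
From HB Require Import structures.
From mathcomp Require Import all_boot all_order all_algebra.
From mathcomp Require Import reals.
From mathcomp Require Import ring.

Set Implicit Arguments.
Unset Strict Implicit.
Unset Printing Implicit Defensive.

Import Order.TTheory GRing.Theory Num.Theory.
Import VectorInternalTheory.
Local Open Scope ring_scope.

HB.mixin Record Vector_isLieAlgebra (F : fieldType) L of Vector F L := {
  lie : L -> L -> L;
  lie_bilinear : bilinear_for *:%R *:%R lie;
  liexx : forall x, lie x x = 0;
  lie_jacobi : forall x y z,
    lie x (lie y z) + lie y (lie z x) + lie z (lie x y) = 0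
}.

#[short(type="lieAlgType")]
HB.structure Definition LieAlgebra (F : fieldType) :=
  { L of Vector_isLieAlgebra F L & Vector F L }.

Section LieTheory.
Variables (F : fieldType) (L : lieAlgType F).
Implicit Types (a : F) (x y z : L).

Let liePl a x y z : lie (a *: x + y) z = a *: lie x z + lie y z.
Proof. exact: lie_bilinear.1. Qed.

Let liePr a x y z : lie x (a *: y + z) = a *: lie x y + lie x z.
Proof. exact: lie_bilinear.2. Qed.

Lemma lieDl x y z : lie (x + y) z = lie x z + lie y z.
Proof. by have := liePl 1 x y z; rewrite !scale1r. Qed.

Lemma lieDr x y z : lie x (y + z) = lie x y + lie x z.
Proof. by have := liePr 1 x y z; rewrite !scale1r. Qed.

Lemma lie0l x : lie 0 x = 0.
Proof. by apply: (addIr (lie 0 x)); rewrite -lieDl !add0r. Qed.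

Lemma lie0r x : lie x 0 = 0.
Proof. by apply: (addIr (lie x 0)); rewrite -lieDr !add0r. Qed.

Lemma lieZl a x y : lie (a *: x) y = a *: lie x y.
Proof. by have := liePl a x 0 y; rewrite lie0l !addr0. Qed.

Lemma lieZr a x y : lie x (a *: y) = a *: lie x y.
Proof. by have := liePr a x y 0; rewrite lie0r !addr0. Qed.

Lemma lieNl x y : lie (- x) y = - lie x y.
Proof. by rewrite -scaleN1r lieZl scaleN1r. Qed.

Lemma lieNr x y : lie x (- y) = - lie x y.
Proof. by rewrite -scaleN1r lieZr scaleN1r. Qed.

Lemma lieC x y : lie x y = - lie y x.
Proof.
apply/eqP; rewrite -addr_eq0; apply/eqP.
by have := liexx (x + y); rewrite lieDl !lieDr !liexx add0r addr0.
Qed.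

End LieTheory.

Record derivation_rep (F : fieldType) (h k : lieAlgType F) := DerivationRep {
  drep :> 'Hom(h, 'End(k));
  drep_lie : forall x y v,
    drep (lie x y) v = drep x (drep y v) - drep y (drep x v);
  drep_der : forall x u v,
    drep x (lie u v) = lie (drep x u) v + lie u (drep x v)
}.

(* The subalgebra h is { (x, 0) } and the ideal k is { (0, v) }. *)
Definition semidirect (F : fieldType) (h k : lieAlgType F)
  (pi : derivation_rep h k) : Type := (h * k)%type.

Section SemidirectLie.
Variables (F : fieldType) (h k : lieAlgType F) (pi : derivation_rep h k).

Let v2rE :=
  (@linearD _ k _ _ v2r, @linearN _ k _ _ v2r, @linearZ_LR _ k _ _ v2r).

HB.instance Definition _ := Vector.copy (semidirect pi) (h * k)%type.

Definition sd_lie (p q : semidirect pi) : semidirect pi :=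
  (lie p.1 q.1, pi p.1 q.2 - pi q.1 p.2 + lie p.2 q.2).

Lemma sd_lie_bilinear : bilinear_for *:%R *:%R sd_lie.
Proof.
split=> [[z w] a [x u] [y v]|[z w] a [x u] [y v]].
  congr pair => /=; first by rewrite lieDl lieZl.
  rewrite !linearP add_lfunE scale_lfunE lieDl lieZl.
  by apply: v2r_inj; apply/rowP=> i; rewrite ?v2rE !mxE; ring.
congr pair => /=; first by rewrite lieDr lieZr.
rewrite !linearP add_lfunE scale_lfunE lieDr lieZr.
by apply: v2r_inj; apply/rowP=> i; rewrite ?v2rE !mxE; ring.
Qed.

Lemma sd_liexx p : sd_lie p p = 0.
Proof. by rewrite /sd_lie !liexx subrr addr0. Qed.

Lemma sd_lie_jacobi p q r :
  sd_lie p (sd_lie q r) + sd_lie q (sd_lie r p) + sd_lie r (sd_lie p q) = 0.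
Proof.
case: p q r => [x u] [y v] [z w]; congr pair => /=; first exact: lie_jacobi.
rewrite !drep_lie !linearD !linearN /= !drep_der !lieDr !lieNr.
rewrite [lie (pi x v) w]lieC [lie (pi y w) u]lieC [lie (pi z u) v]lieC.
rewrite -[RHS](lie_jacobi u v w).
by apply: v2r_inj; apply/rowP=> i; rewrite ?v2rE !mxE; ring.
Qed.

HB.instance Definition _ := Vector_isLieAlgebra.Build F (semidirect pi)
  sd_lie_bilinear sd_liexx sd_lie_jacobi.

End SemidirectLie.

Notation inner_product V := {dot V for idfun}.

Definition so (R : realType) (V : vectType R) (ip : inner_product V)
  (f : 'End(V)) : Prop := forall x y, ip (f x) y = - ip x (f y).

Record almostHermitian (R : realType) (L : lieAlgType R) := AlmostHermitian {
  metric : inner_product L;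
  acs : 'End(L);
  acsK : forall x, acs (acs x) = - x;
  acs_isometry : forall x y, metric (acs x) (acs y) = metric x y
}.

Section Kahler.
Variables (R : realType) (L : lieAlgType R) (A : almostHermitian L).
Let J := acs A.

Definition fundamental_form (x y : L) : R := metric A (J x) y.

Definition almost_kahler : Prop := forall x y z : L,
  fundamental_form (lie x y) z + fundamental_form (lie y z) x
    + fundamental_form (lie z x) y = 0.

Definition integrable : Prop := forall y z : L,
  lie (J y) (J z) - lie y z - J (lie (J y) z) - J (lie y (J z)) = 0.

Definition kahler : Prop := almost_kahler /\ integrable.

End Kahler.

Section SemidirectHermitian.
Variables (R : realType) (h k : lieAlgType R) (pi : derivation_rep h k).
Variables (ip : inner_product h) (j : 'Hom(h, k)) (hj : bijective j).

Definition sd_acs_fun (p : semidirect pi) : semidirect pi :=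
  (- (j^-1)%VF p.2, j p.1).

Fact sd_acs_fun_linear : linear sd_acs_fun.
Proof.
move=> a [x u] [y v]; congr pair => /=; last by rewrite linearP.
by rewrite linearP opprD scalerN.
Qed.

HB.instance Definition _ :=
  GRing.isLinear.Build R (semidirect pi) (semidirect pi) *:%R sd_acs_fun
    sd_acs_fun_linear.

Definition sd_acs : 'End(semidirect pi) := linfun sd_acs_fun.

Let jK : cancel j (j^-1)%VF.
Proof. by apply/lker0_lfunK/lker0P; exact: bij_inj. Qed.

Let jVK : cancel (j^-1)%VF j.
Proof.
by move=> v; case: hj => i _ ji; rewrite -[in LHS](ji v) jK ji.
Qed.

Fact sd_acsK p : sd_acs (sd_acs p) = - p.
Proof.
case: p => x u; rewrite !lfunE; congr pair => /=; first by rewrite jK.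
by rewrite linearN /= jVK.
Qed.

(* Makes hj an argument, so that the instance below, whose positive
   definiteness needs the bijectivity of j, applies to sd_metric. *)
Definition sd_metric of bijective j := fun p q : semidirect pi =>
  ip p.1 q.1 + ip ((j^-1)%VF p.2) ((j^-1)%VF q.2).

Fact sd_metric_bilinear :
  bilinear_for *%R (idfun \; *%R) (sd_metric hj).
Proof.
split=> [[z w] a [x u] [y v]|[z w] a [x u] [y v]].
  by rewrite /sd_metric /= linearP !linearPl /=; ring.
by rewrite /sd_metric /= (linearP (j^-1)%VF) !linearPr /=; ring.
Qed.

HB.instance Definition _ :=
  bilinear_isBilinear.Build R (semidirect pi) (semidirect pi) R *%R
    (idfun \; *%R) (sd_metric hj) sd_metric_bilinear.

Fact sd_metric_sym p q :
  sd_metric hj p q = (-1) ^+ false * idfun (sd_metric hj q p).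
Proof.
have C x y : ip x y = ip y x by rewrite hermC /= mul1r.
by rewrite /sd_metric /= mul1r C [X in _ + X]C.
Qed.

HB.instance Definition _ :=
  isHermitianSesquilinear.Build R (semidirect pi) false idfun (sd_metric hj)
    sd_metric_sym.

Fact sd_metric_gt0 p : p != 0 -> 0 < sd_metric hj p p.
Proof.
have ge0 x : 0 <= ip x x.
  have [->|/neq0_dnorm_gt0/ltW//] := eqVneq x 0.
  by rewrite linear0l.
case: p => x u; have [->|x0 _] := eqVneq x 0; last first.
  by rewrite /sd_metric ltr_pwDl ?neq0_dnorm_gt0.
have [->|u0 _] := eqVneq u 0; first by rewrite eqxx.
rewrite /sd_metric ltr_pwDr // neq0_dnorm_gt0 //=.
by apply: contraNneq u0 => ju0; rewrite -[u]jVK ju0 linear0.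
Qed.

HB.instance Definition _ :=
  isDotProduct.Build R (semidirect pi) (sd_metric hj) sd_metric_gt0.

Fact sd_acs_isometry p q :
  sd_metric hj (sd_acs p) (sd_acs q) = sd_metric hj p q.
Proof.
case: p q => [x u] [y v]; rewrite !lfunE /sd_metric /= !jK.
by rewrite linearNl linearNr opprK addrC.
Qed.

Definition sd_hermitian : almostHermitian (semidirect pi) :=
  AlmostHermitian (metric := sd_metric hj) sd_acsK sd_acs_isometry.

End SemidirectHermitian.

(* Main.v *)
Require Import Defs.
From HB Require Import structures.
From mathcomp Require Import all_boot all_order all_algebra.
From mathcomp Require Import reals.
From mathcomp Require Import ring.

Set Implicit Arguments.
Unset Strict Implicit.
Unset Printing Implicit Defensive.

Import Order.TTheory GRing.Theory Num.Theory.
Import VectorInternalTheory.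
Local Open Scope ring_scope.

(* Write P x for j^-1 (pi x) j, so that omega((x, j a), (y, j b)) is
   <x, b> - <a, y>.  Closedness of omega on (x, j b, j c) says that k is
   abelian; on (x, y, j c), together with the skew-symmetry of P, it says that
   [x, y] = P x y - P y x.  Once k is abelian, every component of the Nijenhuis
   tensor is a sum of two instances of the latter identity. *)

Lemma inner_product_eq0 (R : realType) (V : vectType R) (ip : inner_product V)
  (x : V) : (forall y, ip x y = 0) -> x = 0.
Proof.
move=> x0; apply/eqP; apply: contraT => /neq0_dnorm_gt0 -/(_ _ ip).
by rewrite x0 ltxx.
Qed.

Section AlmostKahlerSemidirect.
Variables (R : realType) (h k : lieAlgType R) (pi : derivation_rep h k).
Variables (ip : inner_product h) (j : 'Hom(h, k)) (hj : bijective j).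

Let P x := (j^-1 \o pi x \o j)%VF.

Let jK : cancel j (j^-1)%VF.
Proof. by apply/lker0_lfunK/lker0P; exact: bij_inj. Qed.

Let jVK : cancel (j^-1)%VF j.
Proof.
by move=> v; case: hj => i _ ji; rewrite -[in LHS](ji v) jK ji.
Qed.

Lemma rep_conj x y : pi x (j y) = j (P x y).
Proof. by rewrite /P !comp_lfunE jVK. Qed.

(** Writing [k] as the image of [j] keeps all computations in [h] and makes both summands visibly
    Lagrangian. *)
Lemma sd_fundamental_formE (x a y b : h) :
  fundamental_form (sd_hermitian pi ip hj) (x, j a) (y, j b)
  = ip x b - ip a y.
Proof.
rewrite /fundamental_form /= /sd_acs lfunE /sd_metric /= !jK.
by rewrite linearNl addrC.
Qed.

Lemma sd_lieE (x a y b : h) :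
  lie ((x, j a) : semidirect pi) (y, j b)
  = (lie x y, j (P x b - P y a + (j^-1)%VF (lie (j a) (j b)))).
Proof. by rewrite linearD linearB /= -!rep_conj jVK. Qed.

Let P0l x : P 0 x = 0.
Proof. by rewrite !comp_lfunE linear0 lfunE /= linear0. Qed.

Let PNl x y : P (- x) y = - P x y.
Proof. by rewrite !comp_lfunE linearN lfunE /= linearN. Qed.

Lemma sd_acsE (x a : h) : sd_acs pi j (x, j a) = (- a, j x).
Proof. by rewrite lfunE /= /sd_acs_fun /= jK. Qed.

Hypothesis ak : almost_kahler (sd_hermitian pi ip hj).

(** As [k] is a Lagrangian ideal, the two terms of closedness bracketing with [x] vanish; the third
    pairs [x] with [j^-1 [u, v]]. *)
Lemma almost_kahler_ideal_abelian (u v : k) : lie u v = 0.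
Proof.
rewrite -(jVK u) -(jVK v) -[LHS]jVK.
rewrite [(j^-1)%VF (lie _ _)](inner_product_eq0 (ip := ip)) ?linear0 // => x.
have := ak (x, j 0) (0, j ((j^-1)%VF u)) (0, j ((j^-1)%VF v)).
rewrite !sd_lieE !sd_fundamental_formE !P0l !(linear0, lie0l, lie0r).
rewrite !(linear0l, linear0r) !(subr0, sub0r, add0r, addr0, oppr0).
by move=> /eqP; rewrite oppr_eq0 => /eqP.
Qed.

Hypothesis hso : forall x, so ip (P x).

(** With skew-symmetry, this makes [P] the Levi-Civita connection of [ip] on [h]. *)
Lemma almost_kahler_torsion_free (x y : h) : lie x y = P x y - P y x.
Proof.
have C a b : ip a b = ip b a by rewrite hermC /= mul1r.
apply/eqP; rewrite -subr_eq0; apply/eqP.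
apply: (inner_product_eq0 (ip := ip)) => c.
have := ak (x, j 0) (y, j 0) (0, j c).
rewrite !sd_lieE !sd_fundamental_formE !P0l !almost_kahler_ideal_abelian.
rewrite !(linear0, linear0l, linear0r) !(subr0, sub0r, add0r, addr0, oppr0).
(* Skew-symmetry moves [P y] and [P x] off the test vector [c], so that [c] is paired with the
   torsion. *)
rewrite !(linearBl, linearNl) /= (hso y c x) (hso x c y) !(C c) => e.
by rewrite -[RHS]e; ring.
Qed.

Lemma almost_kahler_integrable : integrable (sd_hermitian pi ip hj).
Proof.
move=> [y u] [z v]; rewrite -(jVK u) -(jVK v).
move: ((j^-1)%VF u) ((j^-1)%VF v) => a b.
rewrite [acs _]/= 2!sd_acsE 4!sd_lieE 2!sd_acsE.
rewrite !almost_kahler_ideal_abelian 4!almost_kahler_torsion_free.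
rewrite linear0 !addr0 !PNl ![P _ (- _)]linearN.
have v2rE := (@linearD _ h _ _ v2r, @linearN _ h _ _ v2r).
congr pair => /=.
  (* The [h] component: torsion vanishes on [(a, b)] and [(y, z)]. Passing to coordinates gives
     scalars, where [ring] applies. *)
  apply: v2r_inj; apply/rowP => i.
  rewrite linear0 !v2rE.
  by rewrite !mxE; ring.
(* The [k] component, with [j] factored out: torsion vanishes on [(a, z)] and [(y, b)]. *)
rewrite -!(linearB j) -[RHS](linear0 j); congr (j _).
apply: v2r_inj; apply/rowP => i.
rewrite linear0 !v2rE.
by rewrite !mxE; ring.
Qed.

End AlmostKahlerSemidirect.

Theorem corollary6p2 (R : realType) (h k : lieAlgType R)
    (pi : derivation_rep h k) (ip : inner_product h)
    (j : 'Hom(h, k)) (hj : bijective j)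
    (hso : forall x : h, so ip (j^-1 \o pi x \o j)%VF) :
  almost_kahler (sd_hermitian pi ip hj) -> kahler (sd_hermitian pi ip hj).
Proof. by move=> ak; split=> //; exact: almost_kahler_integrable. Qed.
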